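(* Let $\nabla_1>0$ be an integer. There exists a distributed algorithm in the LOCAL model which, on every input graph $G$ with $\nabla_1(G)\le \nabla_1$, runs in a constant number of rounds and outputs a dominating set of $G$ of size $\mathcal{O}(\gamma(G))$; that is, there are constants $r$ and $c$ depending only on $\nabla_1$ such that the algorithm terminates after at most $r$ communication rounds and outputs a dominating set $D'$ with $|D'|\le c\cdot\gamma(G)$.
   Context: All graphs are finite, undirected and simple. In the LOCAL model the input graph is the communication network: each vertex is a processor with a unique identifier, initially knowing nothing about the graph; in each synchronous round every vertex may send arbitrary messages to its neighbours and perform arbitrary local computation; at the end each vertex decides whether it belongs to the output set. A dominating set of $G$ is a set $D\subseteq V(G)$ such that every vertex is in $D$ or has a neighbour in $D$; $\gamma(G)$ is the minimum size of a dominating set. A graph $H$ is a $1$-shallow minor of $G$ if $H$ can be obtained from $G$ by deleting vertices and edges and then contracting pairwise vertex-disjoint connected subgraphs of radius at most $1$ (i.e. stars) to single vertices. $\nabla_1(G)$ denotes the maximum of $|E(H)|/|V(H)|$ over all $1$-shallow minors $H$ of $G$. *)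

(* Defs.v *)
From mathcomp Require Import all_boot.
Set Implicit Arguments. Unset Strict Implicit. Unset Printing Implicit Defensive.

Definition simple_graph (T : finType) (e : rel T) : Prop :=
  symmetric e /\ irreflexive e.

Definition num_edges (T : finType) (e : rel T) : nat :=
  #|[set p : T * T | e p.1 p.2]| %/ 2.

Definition dominating (T : finType) (e : rel T) (D : {set T}) : bool :=
  [forall v, (v \in D) || [exists u in D, e v u]].

(* gamma(G): minimum size of a dominating set (setT is always dominating,
   so the default #|T| is harmless). *)
Definition gamma (T : finType) (e : rel T) : nat :=
  \big[minn/#|T|]_(D : {set T} | dominating e D) #|D|.

(* B : T' -> {set T} is a model of H = (T', e') as a 1-shallow minor of
   G = (T, e): branch sets are pairwise disjoint, each has a centre adjacent
   to all its other vertices (a star, i.e. connected of radius <= 1, which in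
   particular makes it nonempty), and every edge of H is realised by an
   edge of G between the two branch sets. *)
Definition shallow1_model (T : finType) (e : rel T)
    (T' : finType) (e' : rel T') (B : T' -> {set T}) : Prop :=
  (forall x y : T', x != y -> [disjoint B x & B y]) /\
  (forall x : T', exists2 c, c \in B x & forall u, u \in B x -> u != c -> e c u) /\
  (forall x y : T', e' x y -> exists u w, [/\ u \in B x, w \in B y & e u w]).

Definition is_shallow1_minor (T : finType) (e : rel T)
    (T' : finType) (e' : rel T') : Prop :=
  simple_graph e' /\ exists B : T' -> {set T}, shallow1_model e e' B.

(* nabla_1(G) <= d, i.e. |E(H)| / |V(H)| <= d for every 1-shallow minor H
   (stated multiplicatively; empty H contributes no constraint). *)
Definition nabla1_le (T : finType) (e : rel T) (d : nat) : Prop :=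
  forall (T' : finType) (e' : rel T'),
    is_shallow1_minor e e' -> num_edges e' <= d * #|T'|.

Fixpoint ball (T : finType) (e : rel T) (k : nat) (v : T) : {set T} :=
  if k is k'.+1 then
    ball e k' v :|: [set u | [exists w in ball e k' v, e w u]]
  else [set v].

Definition inner_ball (T : finType) (e : rel T) (k : nat) (v : T) : {set T} :=
  if k is k'.+1 then ball e k' v else set0.

(* Edges known to v after k rounds: those with an endpoint at distance <= k-1. *)
Definition view_edge (T : finType) (e : rel T) (k : nat) (v u w : T) : bool :=
  e u w && ((u \in inner_ball e k v) || (w \in inner_ball e k v)).

Definition same_view (k : nat)
    (T : finType) (e : rel T) (id : T -> nat) (v : T)
    (T' : finType) (e' : rel T') (id' : T' -> nat) (v' : T') : Prop :=
  id v = id' v' /\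
  (forall n : nat, (exists2 u, u \in ball e k v & id u = n) <->
                   (exists2 u', u' \in ball e' k v' & id' u' = n)) /\
  (forall n m : nat,
      (exists u w, [/\ view_edge e k v u w, id u = n & id w = m]) <->
      (exists u' w', [/\ view_edge e' k v' u' w', id' u' = n & id' w' = m])).

(* A (deterministic) distributed algorithm: on input graph (T,e) with
   identifiers id, vertex v outputs A T e id v (membership in the output set). *)
Definition dist_alg : Type :=
  forall (T : finType), rel T -> (T -> nat) -> T -> bool.

(* A runs in at most r rounds of the LOCAL model: each vertex's output is a
   function of its radius-r identifier-labelled view (full-information
   gathering), on every simple graph with unique identifiers. *)
Definition local_in_rounds (r : nat) (A : dist_alg) : Prop :=
  forall (T : finType) (e : rel T) (id : T -> nat) (v : T)
         (T' : finType) (e' : rel T') (id' : T' -> nat) (v' : T'),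
    simple_graph e -> injective id ->
    simple_graph e' -> injective id' ->
    same_view r e id v e' id' v' ->
    A T e id v = A T' e' id' v'.

Definition output_set (A : dist_alg) (T : finType) (e : rel T) (id : T -> nat)
  : {set T} := [set v | A T e id v].

(* Main.v *)
Require Import Defs.
From mathcomp Require Import all_boot.
From mathcomp Require Import zify.
Set Implicit Arguments. Unset Strict Implicit. Unset Printing Implicit Defensive.

(* Write N[v] for the closed neighbourhood.  Call v near z if, after deleting
   the neighbourhoods of some boundedly many vertices, N[v] covers a constant
   fraction of what is left of N[z], provided enough is left; by sparsity only
   boundedly many v are near a given z.  A vertex v defers if N[v] is covered by
   k = 2d neighbourhoods N[z] such that v is not near z; the algorithm outputs
   the vertices that do not defer, plus all vertices these do not dominate.

   Let D be a minimum dominating set.  Contracting stars around D shows that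
   N[v] is covered by k members of D for all but O(|D|) vertices v, and such a v
   can only fail to defer if it is near a member of D.  So O(|D|) vertices do not
   defer.

   It remains to see that each N[v] has boundedly many undominated vertices u.
   Fix for each deferring w a witnessing cover Z(w), and close {v} under
   w |-> Z(w) inside N[u].  If the closure has more than b vertices, where b
   bounds the edge density, then u has more than b neighbours in a set of bounded
   size depending only on v, and there are few such u.  Otherwise the closure W
   is bounded; delete the neighbourhoods of all vertices of the Z(w), w in W,
   that are not adjacent to u.  The largest remaining neighbourhood of a member
   of W is covered by k remaining neighbourhoods of members of W, each meeting it
   in less than a k-th of their size unless they are small.  So only few vertices
   of N[v], u among them, remain, and there are boundedly many possible sets
   whose neighbourhoods were deleted. *)

(** * Selected vertices in sparse graphs *)

Section Graph.
Variables (T : finType) (e : rel T).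

Definition cnbh (x : T) : {set T} := [set y | (y == x) || e x y].

Definition cov (Q : {set T}) : {set T} := \bigcup_(x in Q) cnbh x.

Definition near (q m L : nat) (z v : T) : bool :=
  [exists Q : {set T}, [&& #|Q| <= q, L <= #|cnbh z :\: cov Q| &
     #|cnbh z :\: cov Q| <= m * #|(cnbh z :&: cnbh v) :\: cov Q|]].

Definition deferring (k q m L : nat) (v : T) (Z : {set T}) : bool :=
  [&& #|Z| <= k, cnbh v \subset cov Z & [forall z in Z, ~~ near q m L z v]].

Definition selected (k q m L : nat) : {set T} :=
  [set v | ~~ [exists Z : {set T}, deferring k q m L v Z]].

Definition domset (k q m L : nat) : {set T} :=
  selected k q m L :|: ~: cov (selected k q m L).

Definition sparse (b : nat) : Prop := forall X Y : {set T},
  \sum_(x in X) #|Y :&: cnbh x| <= b * (#|X| + #|Y|).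

Lemma cnbh_refl x : x \in cnbh x. Proof. by rewrite inE eqxx. Qed.

Lemma covP (Q : {set T}) y : reflect (exists2 x, x \in Q & y \in cnbh x) (y \in cov Q).
Proof. exact: bigcupP. Qed.

Lemma cov0 : cov set0 = set0. Proof. by rewrite /cov big_set0. Qed.

Lemma covU A B : cov (A :|: B) = cov A :|: cov B.
Proof. exact: bigcup_setU. Qed.

Lemma card_bigcup_le (I : finType) (X : {set I}) (F : I -> {set T}) n :
  (forall i, i \in X -> #|F i| <= n) -> #|\bigcup_(i in X) F i| <= n * #|X|.
Proof.
move=> H; rewrite mulnC -sum_nat_const.
elim/big_ind2: _ => [|A a B c HA HB|i iX]; first by rewrite cards0.
  exact: leq_trans (leq_card_setU _ _) (leq_add HA HB).
exact: H.
Qed.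

(** * Few vertices are near a given one *)

Section Sparse.
Variable b : nat.
Hypothesis spb : sparse b.

(** Double counting gives |X||A| <= mb(|X| + |A|) for the set X in question; as mb is at most |A|/2,
    half of the left side absorbs mb|X|. *)
Lemma dense_bound m (A : {set T}) : 2 * m * b <= #|A| -> 0 < #|A| ->
  #|[set x | #|A| <= m * #|A :&: cnbh x|]| <= 2 * m * b.
Proof.
move=> LA A0; set X := [set x | _].
have H : #|X| * #|A| <= m * (b * (#|X| + #|A|)).
  apply: leq_trans (leq_mul (leqnn m) (spb X A)).
  rewrite -sum_nat_const big_distrr /=; apply: leq_sum => x.
  by rewrite inE.
nia.
Qed.

(** [near] with an arbitrary set in place of N[z], so that an induction on q may delete a
    neighbourhood from it. *)
Definition near_set (q m L : nat) (A : {set T}) : {set T} :=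
  [set v | [exists Q : {set T}, [&& #|Q| <= q, L <= #|A :\: cov Q| &
     #|A :\: cov Q| <= m * #|(A :&: cnbh v) :\: cov Q|]]].

Fixpoint near_bound (M q : nat) : nat :=
  if q is q'.+1 then M + near_bound M q' * M else M.

(* Either some element of Q already covers a fixed fraction of A, and is one of
   few such vertices, or Q misses half of A, which makes v one of them. *)
Lemma card_near_set q0 m q L (A : {set T}) : q <= q0 ->
  L = 2 * (2 * (m + q0).+1) * b + 1 -> #|near_set q m L A| <= near_bound L q.
Proof.
move=> qq0 LE.
(* As m2 >= 2 q0, at most q0 neighbourhoods, each covering less than |A|/m2, cover at most half of
   A; as m2 >= 2m, a fraction 1/m of the other half is a fraction 1/m2 of A. Using q0 keeps m2 fixed
   while q decreases. *)
set m2 := 2 * (m + q0).+1.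
have dnb (B : {set T}) : L <= #|B| -> #|[set x | #|B| <= m2 * #|B :&: cnbh x|]| <= L.
  move=> LB; apply: leq_trans (dense_bound (m := m2) (A := B) _ _) _; rewrite LE /m2 in LB *; lia.
elim: q qq0 A => [|q IH] qq0 A /=.
  have [LA|LA] := leqP L #|A|; last first.
    rewrite (_ : near_set _ _ _ _ = set0) ?cards0 //; apply/setP => v; rewrite !inE.
    apply/existsP => -[Q /and3P[_ H _]].
    by move: (leq_trans H (subset_leq_card (subsetDl A (cov Q)))); rewrite leqNgt LA.
  apply: leq_trans (subset_leq_card _) (dnb _ LA); apply/subsetP => v; rewrite !inE.
  case/existsP=> Q /and3P[]; rewrite leqn0 cards_eq0 => /eqP-> _.
  by rewrite cov0 !setD0; move/leq_trans; apply; rewrite leq_mul2r /m2; apply/orP; right; lia.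
have [LA|LA] := leqP L #|A|; last first.
  rewrite (_ : near_set _ _ _ _ = set0) ?cards0 //; apply/setP => v; rewrite !inE.
  apply/existsP => -[Q /and3P[_ H _]].
  by move: (leq_trans H (subset_leq_card (subsetDl A (cov Q)))); rewrite leqNgt LA.
set X := [set x | #|A| <= m2 * #|A :&: cnbh x|].
have XL : #|X| <= L by exact: dnb.
have sub : near_set q.+1 m L A \subset
    X :|: \bigcup_(x in X) near_set q m L (A :\: cnbh x).
  apply/subsetP => v; rewrite inE => /existsP[Q /and3P[Qq LQ mQ]].
  have [x /andP[xQ xX]|noX] := pickP [pred x in Q | x \in X].
    apply/setUP; right; apply/bigcupP; exists x => //; rewrite inE.
    apply/existsP; exists (Q :\ x).
    have cx : cov Q = cnbh x :|: cov (Q :\ x).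
      by rewrite -{1}(setD1K xQ) covU /cov big_set1.
    have AE (B : {set T}) : B :\: cnbh x :\: cov (Q :\ x) = B :\: cov Q.
      by rewrite cx setDDl.
    rewrite setIDAC !AE LQ mQ !andbT.
    by move: Qq; rewrite (cardsD1 x) xQ.
  apply/setUP; left; rewrite inE.
  have small : #|A :&: cov Q| * m2 <= q0 * #|A|.
    have AQ : A :&: cov Q = \bigcup_(x in Q) (A :&: cnbh x).
      by rewrite /cov big_distrr.
    have : #|A :&: cov Q| <= \sum_(x in Q) #|A :&: cnbh x|.
      rewrite AQ; elim/big_ind2: _ => [|B p C r HB HC|//]; first by rewrite cards0.
      exact: leq_trans (leq_card_setU _ _) (leq_add HB HC).
    move=> /(leq_mul (leqnn m2)); rewrite mulnC => /leq_trans; apply.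
    rewrite big_distrr /=; apply: (@leq_trans (\sum_(x in Q) #|A|)).
      apply: leq_sum => x xQ; move: (noX x); rewrite /= xQ /= inE leqNgt => /negbFE.
      exact: ltnW.
    by rewrite sum_nat_const leq_mul2r (leq_trans Qq qq0) orbT.
  have half : #|A| <= 2 * #|A :\: cov Q|.
    have := cardsID (cov Q) A; rewrite /m2 in small; nia.
  apply: leq_trans half _.
  apply: leq_trans (leq_mul (leqnn 2) mQ) _.
  rewrite mulnA leq_mul ?subset_leq_card ?subsetDl // /m2; lia.
apply: leq_trans (subset_leq_card sub) _.
apply: leq_trans (leq_card_setU _ _) (leq_add XL _).
apply: leq_trans (leq_mul (leqnn (near_bound L q)) XL).
apply: card_bigcup_le => x _; apply: IH; exact: ltnW.
Qed.

Lemma near_setE q m L z : near_set q m L (cnbh z) = [set v | near q m L z v].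
Proof. by []. Qed.

(** * Undominated vertices in one neighbourhood *)

Section Undominated.
Hypothesis sym_e : symmetric e.
Variables (k q L : nat).
Hypothesis L_gt0 : 0 < L.
Let m := k.+1.
Let S := selected k q m L.

Lemma cnbhC x y : (x \in cnbh y) = (y \in cnbh x).
Proof. by rewrite !inE eq_sym sym_e. Qed.

(** One cover per vertex, fixed independently of u; the default [set0] keeps the size bound valid
    for selected vertices. *)
Definition deferral (w : T) : {set T} := odflt set0 [pick Z | deferring k q m L w Z].

Lemma card_deferral w : #|deferral w| <= k.
Proof.
by rewrite /deferral; case: pickP => [Z /and3P[]|_] //=; rewrite cards0.
Qed.

Lemma deferralP w : w \notin S -> deferring k q m L w (deferral w).
Proof.
rewrite inE negbK => /existsP[Z dZ]; rewrite /deferral.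
by case: pickP => [//|/(_ Z)]; rewrite dZ.
Qed.

Fixpoint tree (v : T) (j : nat) : {set T} :=
  if j is j'.+1 then tree v j' :|: \bigcup_(w in tree v j') deferral w else [set v].

Lemma card_tree v j : #|tree v j| <= k.+1 ^ j.
Proof.
elim: j => [|j IH] /=; first by rewrite cards1.
apply: leq_trans (leq_card_setU _ _) _.
rewrite expnS mulSn leq_add //.
apply: leq_trans (leq_mul (leqnn k) IH).
by apply: card_bigcup_le => w _; exact: card_deferral.
Qed.

(** Grow W from {v}: as long as some cover has a member in N[u] outside W, add it. Each step gains a
    vertex and goes at most one level deeper in [tree]. *)
Lemma deferral_closure u v j : u \in cnbh v ->
  exists W : {set T}, [/\ v \in W, W \subset tree v j, W \subset cnbh u &
    (forall w, w \in W -> deferral w :&: cnbh u \subset W) \/ j < #|W|].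
Proof.
move=> uv; elim: j => [|j [W [vW Wt Wu H]]].
  by exists [set v]; split; rewrite ?sub1set ?set11 1?cnbhC ?cards1 //; right.
have tj : W \subset tree v j.+1 by apply: subset_trans Wt _; exact: subsetUl.
case: H => [cl|jW]; first by exists W; split=> //; left.
have [/forall_inP cl|] := boolP [forall w in W, deferral w :&: cnbh u \subset W].
  by exists W; split=> //; left.
rewrite negb_forall_in => /exists_inP[w wW /subsetPn[x /setIP[xZ xu] xW]].
exists (x |: W); split.
- by rewrite setU1r.
- rewrite subUset sub1set tj andbT; apply/setUP; right.
  by apply/bigcupP; exists w => //; exact: (subsetP Wt).
- by rewrite subUset sub1set xu.
- by right; rewrite cardsU1 xW.
Qed.

(* Among the w in W take one maximising the part of its neighbourhood missed by
   Q: that part is covered by at most k members of W, each of which, not having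
   w near it, meets it in less than a k-th of the maximum. *)
Lemma closed_rest u v (W : {set T}) :
  let Q := \bigcup_(w in W) (deferral w :\: cnbh u) in
  v \in W -> [disjoint W & S] ->
  (forall w, w \in W -> deferral w :&: cnbh u \subset W) ->
  #|Q| <= q -> #|cnbh v :\: cov Q| < m * L.
Proof.
move=> Q vW WS cl Qq; rewrite ltnNge; apply/negP => big.
pose r w := #|cnbh w :\: cov Q|.
case: (arg_maxnP r vW) => w wW wmax.
have rw : m * L <= r w by apply: leq_trans big (wmax v vW).
have /and3P[_ cw nw] := deferralP (negbT (disjointFr WS wW)).
set X := deferral w :&: cnbh u.
have sub : cnbh w :\: cov Q \subset
    \bigcup_(x in X) ((cnbh x :&: cnbh w) :\: cov Q).
  apply/subsetP => y /setDP[yw yQ]; have /covP[x xZ yx] := subsetP cw _ yw.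
  apply/bigcupP; exists x; last by rewrite inE yQ inE yx.
  rewrite inE xZ /=; apply: contraR yQ => xu.
  apply/covP; exists x => //; apply/bigcupP; exists w => //.
  by rewrite inE xu.
have each x : x \in X -> m * #|(cnbh x :&: cnbh w) :\: cov Q| <= r w.
  move=> xX; have xW := subsetP (cl w wW) _ xX.
  (* A rest of at most L vertices is harmless because r w >= m L; above L, the failure of [near] for
     this very Q bounds the overlap. *)
  have [small|Lx] := leqP #|cnbh x :\: cov Q| L.
    apply: leq_trans rw; rewrite leq_mul2l; apply/orP; right.
    by apply: leq_trans small; rewrite subset_leq_card // setSD // subsetIl.
  apply: leq_trans (wmax x xW); have /setIP[xZ _] := xX.
  have := forall_inP nw x xZ; rewrite negb_exists => /forallP/(_ Q).
  by rewrite Qq (ltnW Lx) /= -ltnNge; exact: ltnW.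
have : m * r w <= k * r w.
  have H : r w <= \sum_(x in X) #|(cnbh x :&: cnbh w) :\: cov Q|.
    apply: leq_trans (subset_leq_card sub) _.
    elim/big_ind2: _ => [|B p C s HB HC|//]; first by rewrite cards0.
    exact: leq_trans (leq_card_setU _ _) (leq_add HB HC).
  apply: leq_trans (leq_mul (leqnn m) H) _; rewrite big_distrr /=.
  apply: (@leq_trans (\sum_(x in X) r w)); first exact: leq_sum.
  rewrite sum_nat_const leq_mul2r.
  apply/orP; right; apply: leq_trans (card_deferral w).
  by rewrite subset_leq_card // subsetIl.
rewrite /m in rw *; nia.
Qed.

(** The term [b * q] counts the vertices with more than b closed neighbours in the tree of depth b;
    the other term sums the small rests of N[v] over all Q inside the tree of depth b + 1, which has
    at most q vertices. *)
Lemma undominated_bound v : k.+1 ^ b.+1 <= q ->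
  #|~: cov S :&: cnbh v| <= b * q + m * L * 2 ^ q.
Proof.
move=> kq; set t := tree v b; set t' := tree v b.+1.
have tt' : t \subset t' by exact: subsetUl.
have t'q : #|t'| <= q := leq_trans (card_tree v b.+1) kq.
pose Y := [set u | b < #|t :&: cnbh u|].
pose F := [set Q in powerset t' | #|cnbh v :\: cov Q| < m * L].
have sub : ~: cov S :&: cnbh v \subset Y :|: \bigcup_(Q in F) (cnbh v :\: cov Q).
  apply/subsetP => u /setIP[uS uv].
  have [W [vW Wt Wu H]] := deferral_closure b uv.
  case: H => [cl|bW]; last first.
    apply/setUP; left; rewrite inE; apply: leq_trans bW _.
    by rewrite subset_leq_card // subsetI Wt.
  apply/setUP; right.
  set Q := \bigcup_(w in W) (deferral w :\: cnbh u).
  have Qt : Q \subset t'.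
    apply/subsetP => x /bigcupP[w wW /setDP[xw _]]; apply/setUP; right.
    by apply/bigcupP; exists w => //; exact: (subsetP Wt).
  (* W lies in N[u], so a selected member would dominate u. *)
  have WS : [disjoint W & S].
    rewrite -setI_eq0; apply/eqP/setP => w; rewrite !in_set0; apply/negP.
    case/setIP=> /(subsetP Wu); rewrite cnbhC => uw wS.
    by move: uS; rewrite inE => /negP; apply; apply/covP; exists w.
  apply/bigcupP; exists Q.
    rewrite inE powersetE Qt /=; apply: (closed_rest (u := u)) => //.
    exact: leq_trans (subset_leq_card Qt) t'q.
  rewrite inE uv andbT; apply/covP => -[x /bigcupP[w _ /setDP[_ xu]] ux].
  by move: xu; rewrite cnbhC ux.
apply: leq_trans (subset_leq_card sub) (leq_trans (leq_card_setU _ _) (leq_add _ _)).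
  have : b.+1 * #|Y| <= b * (#|Y| + #|t|).
    apply: leq_trans (spb Y t); rewrite mulnC -sum_nat_const.
    by apply: leq_sum => u; rewrite inE.
  have : #|t| <= q := leq_trans (subset_leq_card tt') t'q.
  nia.
apply: (@leq_trans (m * L * #|F|)).
  by apply: card_bigcup_le => Q; rewrite inE => /andP[_ /ltnW].
rewrite leq_mul2l; apply/orP; right.
apply: (@leq_trans #|powerset t'|).
  by apply: subset_leq_card; apply/subsetP => Q; rewrite inE => /andP[].
by rewrite card_powerset leq_exp2l.
Qed.

End Undominated.

End Sparse.
End Graph.

(** * Shallow minors and optimal dominating sets *)

Lemma card_pairs (T : finType) (P : {set T}) (F : T -> {set T}) :
  #|[set p : T * T | (p.1 \in P) && (p.2 \in F p.1)]| = \sum_(x in P) #|F x|.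
Proof.
transitivity (\sum_(x in P) \sum_(y in F x) 1).
  rewrite pair_big_dep /= -sum1_card; apply: eq_bigl => p; by rewrite inE.
by apply: eq_bigr => x _; rewrite sum1_card.
Qed.

Section Minor.
Variables (T : finType) (e : rel T) (d : nat).
Hypotheses (simple_e : simple_graph e) (nab : nabla1_le e d).

Let sym_e : symmetric e := simple_e.1.

(** The minor lives on the subtype of Z. Ordered pairs are counted, and the rounding in [num_edges]
    costs the successor. *)
Lemma minor_edges (Z : {set T}) (h : rel T) (B : T -> {set T}) :
  symmetric h -> irreflexive h ->
  {in Z &, forall x y, x != y -> [disjoint B x & B y]} ->
  {in Z, forall x, exists2 c, c \in B x & forall u, u \in B x -> u != c -> e c u} ->
  {in Z &, forall x y, h x y -> exists u w, [/\ u \in B x, w \in B y & e u w]} ->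
  #|[set p : T * T | [&& p.1 \in Z, p.2 \in Z & h p.1 p.2]]| <= (2 * d * #|Z|).+1.
Proof.
move=> hs hi Bd Bc Bh.
pose T' : finType := {x : T | x \in Z}.
pose e' : rel T' := relpre val h.
have mn : is_shallow1_minor e e'.
  split; first by split=> [x y|x]; [exact: hs | exact: hi].
  exists (B \o val); split; first by move=> x y xy; apply: Bd; rewrite ?(valP x) ?(valP y).
  split; first by move=> x; apply: Bc; exact: valP.
  by move=> x y; apply: Bh; exact: valP.
have := nab mn; rewrite /num_edges card_sig.
set E := [set p : T' * T' | _].
set E0 := [set p : T * T | _].
have : #|E0| <= #|E|.
  apply: leq_trans (leq_imset_card (fun p : T' * T' => (val p.1, val p.2)) E).
  apply: subset_leq_card; apply/subsetP => -[x y]; rewrite inE /= => /and3P[xZ yZ hxy].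
  by apply/imsetP; exists (Sub x xZ, Sub y yZ); rewrite ?inE.
rewrite (_ : #|[pred x in Z]| = #|Z|) //; lia.
Qed.

(** Singletons on X and Y form the minor. The extra 2 pays, for nonempty X, for the rounding and for
    each vertex lying in its own closed neighbourhood. *)
Lemma nabla1_sparse : sparse e (2 * d).+2.
Proof.
move=> X Y; have [/eqP|] := posnP #|X|.
  by rewrite cards_eq0 => /eqP->; rewrite big_set0.
move=> X0.
have := @minor_edges (X :|: Y) e set1 sym_e simple_e.2.
set E := [set p : T * T | _] => H.
have {}H : #|E| <= (2 * d * #|X :|: Y|).+1.
  apply: H => [x y _ _ xy|x _|x y _ _ exy].
  - by rewrite disjoints1 inE.
  - by exists x; rewrite ?set11 // => u /set1P-> /eqP.
  - by exists x, y; rewrite !set11.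
have : \sum_(x in X) #|Y :&: cnbh e x| <= #|X| + #|E|.
  apply: (@leq_trans (\sum_(x in X) (1 + #|[set y in Y | e x y]|))).
    apply: leq_sum => x _; rewrite -(cards1 x); apply: leq_trans (leq_card_setU _ _).
    apply: subset_leq_card; apply/subsetP => y; rewrite !inE => /andP[-> /orP[->//|->]].
    by rewrite orbT.
  rewrite big_split /= sum1_card leq_add2l -(card_pairs X (fun x => [set y in Y | e x y])).
  apply: subset_leq_card; apply/subsetP => -[x y]; rewrite !inE /=.
  by case/and3P=> -> -> ->; rewrite orbT.
have := leq_mul (leqnn (2 * d)) (leq_card_setU X Y); rewrite !mulSn; lia.
Qed.

(** Greedy choice: a vertex of least degree within X has at most 2b closed neighbours there; take
    it, delete them and repeat. *)
Lemma sparse_independent b (X : {set T}) : sparse e b -> exists I : {set T},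
  [/\ I \subset X, {in I &, forall x y, ~~ e x y} & #|X| <= 2 * b * #|I|].
Proof.
move=> spb; have [n] := ubnP #|X|; elim: n X => // n IH X Xn.
have [->|[x0 x0X]] := set_0Vmem X.
  by exists set0; split; rewrite ?sub0set ?cards0 // => x; rewrite inE.
case: (arg_minnP (fun x => #|X :&: cnbh e x|) x0X) => x xX' xmin; have xX : x \in X := xX'.
have xb : #|X :&: cnbh e x| <= 2 * b.
  have : #|X| * #|X :&: cnbh e x| <= b * (#|X| + #|X|).
    by apply: leq_trans (spb X X); rewrite -sum_nat_const; apply: leq_sum => y /xmin.
  have : 0 < #|X| by apply/card_gt0P; exists x.
  nia.
have [|I [IX Ii IX']] := IH (X :\: cnbh e x).
  rewrite -ltnS; apply: leq_trans Xn; rewrite ltnS; apply/proper_card/properP; split; first exact: subsetDl.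
  by exists x => //; rewrite inE cnbh_refl.
have xI : x \notin I.
  by apply/negP => /(subsetP IX); rewrite inE cnbh_refl.
have xy y : y \in I -> ~~ e x y.
  by move/(subsetP IX); rewrite !inE negb_or => /andP[/andP[_ ->]].
exists (x |: I); split.
- by rewrite subUset sub1set xX (subset_trans IX) ?subsetDl.
- move=> y z /setU1P[->|yI] /setU1P[->|zI]; rewrite ?simple_e.2 ?xy //.
    by rewrite sym_e xy.
  exact: Ii.
- by rewrite cardsU1 xI; have := cardsID (cnbh e x) X; nia.
Qed.

(** * Counting selected vertices against a dominating set *)

Section Dominators.
Variables (D : {set T}) (f : T -> T).
Hypotheses (fD : forall u, f u \in D) (fN : forall u, u \in cnbh e (f u))
  (fid : {in D, forall x, f x = x}).

(* Contracting the stars around D outside an independent set I of scattered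
   vertices turns each v in I into a vertex of degree > 2d, while the minor
   has only d(|D| + |I|) edges. *)
Lemma card_scattered :
  #|[set v | (v \notin D) && (2 * d < #|f @: cnbh e v|)]| <= 2 * (2 * d).+2 * #|D|.
Proof.
set X := [set v | _].
have [I [IX Ii XI]] := sparse_independent X nabla1_sparse.
apply: leq_trans XI _; rewrite leq_mul2l; apply/orP; right.
have ID x : x \in I -> x \notin D by move/(subsetP IX); rewrite inE => /andP[].
have DI x : x \in D -> x \in I = false by move=> xD; apply/negP => /ID; rewrite xD.
pose a x y := (x \in I) && (y \in f @: cnbh e x).
have aD x y : a x y -> y \in D by case/andP=> _ /imsetP[u _ ->].
have aI x y : a x y -> x \in I by case/andP.
pose h x y := a x y || a y x.
pose B x := if x \in I then [set x] else [set u | (u \notin I) && (f u == x)].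
pose A := [set p : T * T | (p.1 \in I) && (p.2 \in f @: cnbh e p.1)].
pose A' := [set p : T * T | (p.2, p.1) \in A].
have := @minor_edges (D :|: I) h B; set E := [set p : T * T | _] => H.
have {}H : #|E| <= (2 * d * #|D :|: I|).+1.
  apply: H.
  - by move=> x y; rewrite /h orbC.
  - move=> x; rewrite /h orbb; apply/negP => ax.
    by move: (aI _ _ ax); rewrite DI // (aD _ _ ax).
  - move=> x y _ _ xy; rewrite -setI_eq0; apply/eqP/setP => u; rewrite !inE /B.
    case: ifP => xI; case: ifP => yI; rewrite !inE.
    + by apply/negP => /andP[/eqP-> /eqP exy]; move: xy; rewrite exy eqxx.
    + by apply/negP => /and3P[/eqP->]; rewrite xI.
    + by apply/negP => /andP[/andP[uI _] /eqP uy]; move: uI; rewrite uy yI.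
    + by apply/negP => /andP[/andP[_ /eqP fx] /andP[_ /eqP fy]]; move: xy; rewrite -fx fy eqxx.
  - move=> x xZ; exists x.
      rewrite /B; case: ifP => xI; rewrite ?set11 // inE xI fid ?eqxx //.
      by case/setUP: xZ; rewrite ?xI.
    move=> u; rewrite /B; case: ifP => xI; first by move/set1P=> ->; rewrite eqxx.
    rewrite inE => /andP[_ /eqP fu] ux; have := fN u; rewrite fu inE (negPf ux).
    by [].
  - have aB x y : a x y -> exists u w, [/\ u \in B x, w \in B y & e u w].
      move=> axy; have xI := aI _ _ axy; have yD := aD _ _ axy.
      exists x; rewrite /B xI (DI _ yD).
      case/andP: axy => _ /imsetP[u ux yu]; move: ux; rewrite [_ \in cnbh _ _]inE.
      (* If y dominates x itself, the edge xy serves; otherwise u is adjacent to x, hence outside I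
         and contracted into y. *)
      case/orP=> [/eqP ux|exu]; first rewrite {u}ux in yu.
        exists y; rewrite set11 inE (DI _ yD) fid ?eqxx //; split=> //.
        have := fN x; rewrite -yu inE sym_e => /orP[/eqP xy|->//].
        by move: (ID _ xI); rewrite xy yD.
      exists u; rewrite set11 inE yu eqxx andbT; split=> //.
      by apply/negP => uI; move: (Ii _ _ xI uI); rewrite exu.
    move=> x y _ _ /orP[/aB //|/aB[u [w [uy wx euw]]]].
    by exists w, u; rewrite sym_e.
have Acard : (2 * d).+1 * #|I| <= #|A|.
  rewrite /A (card_pairs I (fun x => f @: cnbh e x)) mulnC -sum_nat_const; apply: leq_sum => x xI.
  by move/(subsetP IX): xI; rewrite inE => /andP[].
have A'card : #|A'| = #|A|.
  rewrite -(card_imset (mem A) (f := fun p => (p.2, p.1))); last by move=> [x y] [z t] [-> ->].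
  apply: eq_card => -[x y]; rewrite inE; apply/idP/imsetP => [yx|[[z t] zt [-> ->]] //].
  by exists (y, x).
have : #|A :|: A'| <= #|E|.
  apply: subset_leq_card; apply/subsetP => -[x y]; rewrite !inE /= -!/(a _ _) /h.
  by case/orP=> axy; rewrite axy (aI _ _ axy) (aD _ _ axy) ?orbT.
rewrite cardsU (_ : A :&: A' = set0); last first.
  apply/setP => -[x y]; rewrite !inE /= -!/(a _ _); apply/negP => /andP[/aI xI /aD].
  by move/DI; rewrite xI.
rewrite cards0 A'card => AE.
(* Both orientations together give 2(2d + 1)|I| <= 2d(|D| + |I|) + 1, whence |I| <= |D|. *)
have := leq_mul (leqnn (2 * d)) (leq_card_setU D I); nia.
Qed.

(** For v outside D with few dominators, [f @: cnbh e v] is a candidate cover, which only nearness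
    of v to one of its members can spoil. *)
Lemma card_selected q L :
  #|selected e (2 * d) q (2 * d).+1 L| <=
  #|D| + (2 * (2 * d).+2 * #|D| +
  #|\bigcup_(z in D) [set v | near e q (2 * d).+1 L z v]|).
Proof.
set X := [set v | (v \notin D) && (2 * d < #|f @: cnbh e v|)].
apply: leq_trans (leq_add (leqnn _) (leq_add card_scattered (leqnn _))).
apply: leq_trans (leq_add (leqnn _) (leq_card_setU _ _)).
apply: leq_trans (leq_card_setU _ _).
apply: subset_leq_card; apply/subsetP => v; rewrite inE negb_exists => /forallP/(_ (f @: cnbh e v)).
rewrite in_setU; have [//|vD] := boolP (v \in D).
rewrite in_setU inE vD /=; have [//|few] := ltnP (2 * d) #|f @: cnbh e v|.
rewrite /deferring few /= negb_and negb_forall_in => /orP[/subsetPn[u uv]|].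
  by case/covP; exists (f u) => //; apply: imset_f.
case/exists_inP => z /imsetP[u uv ->]; rewrite negbK => n.
by apply/bigcupP; exists (f u); rewrite ?inE.
Qed.

End Dominators.
End Minor.

(** * The algorithm and its approximation factor *)

Lemma gamma_witness (T : finType) (e : rel T) :
  exists2 D : {set T}, dominating e D & #|D| = gamma e.
Proof.
rewrite /gamma; elim/big_rec: _ => [|D n dD [D' dD' En]].
  exists setT; last by rewrite cardsT.
  by apply/forallP => v; rewrite inE.
by rewrite /minn; case: ltnP => _; [exists D | exists D'].
Qed.

(* The size of a deferral tree of depth b + 1, where b = 2d + 2. *)
Definition gather_size (d : nat) : nat := (2 * d).+1 ^ (2 * d).+3.
(** The threshold L required by [card_near_set] for m = 2d + 1, q0 = [gather_size d] and b = 2d +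
    2. *)
Definition gather_thr (d : nat) : nat :=
  2 * (2 * ((2 * d).+1 + gather_size d).+1) * (2 * d).+2 + 1.

Definition alg_set (d : nat) (T : finType) (e : rel T) : {set T} :=
  domset e (2 * d) (gather_size d) (2 * d).+1 (gather_thr d).

Lemma dominating_alg_set d (T : finType) (e : rel T) : symmetric e ->
  dominating e (alg_set d e).
Proof.
move=> se; apply/forallP => v; rewrite /alg_set /domset.
set S := selected _ _ _ _ _.
have [vS|] := boolP (v \in S :|: _) => //=.
rewrite in_setU in_setC negb_or negbK => /andP[vS /covP[x xS]].
rewrite inE => /orP[/eqP vx|exv]; first by rewrite vx xS in vS.
by apply/exists_inP; exists x; rewrite ?in_setU ?xS // se.
Qed.

Lemma card_alg_set d : exists c, forall (T : finType) (e : rel T),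
  simple_graph e -> nabla1_le e d -> #|alg_set d e| <= c * gamma e.
Proof.
set q := gather_size d; set L := gather_thr d.
set b := (2 * d).+2; set m := (2 * d).+1.
(* Per member of D: itself, its share of the scattered vertices, the vertices near it, and the
   undominated vertices in its neighbourhood. *)
exists ((1 + (2 * b + near_bound L q)) + (b * q + m * L * 2 ^ q)) => T e se ne.
have [D dD <-] := gamma_witness e.
have sp := nabla1_sparse se ne.
have [f fP] : exists f : T -> T, forall u,
    [/\ f u \in D, u \in cnbh e (f u) & u \in D -> f u = u].
  apply: (fin_all_exists (P := fun u y =>
    [/\ y \in D, u \in cnbh e y & u \in D -> y = u])) => u; have [uD|uD] := boolP (u \in D).
    by exists u; rewrite cnbh_refl.
  have := forallP dD u; rewrite (negPf uD) => /exists_inP[x xD eux].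
  by exists x; rewrite xD inE se.1 eux orbT.
rewrite mulnDl; apply: leq_trans (leq_card_setU _ _) (leq_add _ _).
  have := @card_selected T e d se ne D f _ _ _ q L.
  move=> /(_ (fun u => let: And3 a _ _ := fP u in a)).
  move=> /(_ (fun u => let: And3 _ a _ := fP u in a)).
  move=> /(_ (fun u => let: And3 _ _ a := fP u in a)) /leq_trans; apply.
  rewrite !mulnDl mul1n !leq_add //; apply: card_bigcup_le => z _.
  rewrite -near_setE; exact: (card_near_set sp (q0 := q)).
set U := ~: _.
have sub : U \subset \bigcup_(v in D) (U :&: cnbh e v).
  apply/subsetP => u uU; have [fD fN _] := fP u.
  by apply/bigcupP; exists (f u); rewrite // inE uU.
apply: leq_trans (subset_leq_card sub) _.
apply: card_bigcup_le => v _.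
apply: (undominated_bound sp se.1) => //.
Qed.

(** * Locality *)

Section Balls.
Variables (T : finType) (e : rel T) (v : T).

Lemma ball_mono i j : i <= j -> ball e i v \subset ball e j v.
Proof.
move=> /subnKC<-; elim: (j - i) => [|n IH]; first by rewrite addn0.
by rewrite addnS; apply: subset_trans IH _; exact: subsetUl.
Qed.

Lemma ball_cnbh j x y : x \in ball e j v -> y \in cnbh e x -> y \in ball e j.+1 v.
Proof.
move=> xj; rewrite inE => /orP[/eqP->|exy]; first by rewrite /= inE xj.
by rewrite /= !inE; apply/orP; right; apply/exists_inP; exists x.
Qed.
End Balls.

(** Assumed in both directions, this is an isomorphism of views. Neighbourhoods are respected only
    below radius r, since edges between two vertices at distance r are invisible. *)
Definition ball_hom (r : nat) (T : finType) (e : rel T) (v : T)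
    (T' : finType) (e' : rel T') (v' : T') (h : T -> T') (h' : T' -> T) : Prop :=
  forall j x, j <= r -> x \in ball e j v ->
    [/\ h x \in ball e' j v', h' (h x) = x &
        j < r -> forall y, y \in cnbh e x -> h y \in cnbh e' (h x)].

Section Transport.
Variables (r : nat) (T : finType) (e : rel T) (v : T).
Variables (T' : finType) (e' : rel T') (v' : T') (h : T -> T') (h' : T' -> T).
Hypotheses (se : symmetric e) (hom : ball_hom r e v e' v' h h')
  (hom' : ball_hom r e' v' e v h' h).

Lemma card_ball_image (X : {set T}) : X \subset ball e r v -> #|h @: X| = #|X|.
Proof.
move=> XB; apply: card_in_imset => x y /(subsetP XB) xB /(subsetP XB) yB E.
have [_ hx _] := hom (leqnn r) xB; have [_ hy _] := hom (leqnn r) yB.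
by rewrite -hx E hy.
Qed.

Lemma cnbh_image j x : j < r -> x \in ball e j v -> cnbh e' (h x) = h @: cnbh e x.
Proof.
move=> jr xj; have [hxj hx hn] := hom (ltnW jr) xj.
apply/setP => y'; apply/idP/imsetP => [y'N|[y yN ->]]; last exact: hn.
have [_ E _] := hom' jr (ball_cnbh hxj y'N).
exists (h' y') => //; rewrite -{1}hx.
by have [_ _ hn'] := hom' (ltnW jr) hxj; apply: hn'.
Qed.

(** Q ranges over the whole graph, but only its members in N[y] matter, so it may be cut to the next
    larger ball before being transported. *)
Lemma mem_cov_image j y (Q : {set T}) : j.+1 < r -> y \in ball e j v ->
  (h y \in cov e' (h @: (Q :&: ball e j.+1 v))) = (y \in cov e Q).
Proof.
move=> jr yj; apply/covP/covP => -[x].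
  case/imsetP=> z /setIP[zQ zB] -> hyz; exists z => //.
  have [hzB hz _] := hom (ltnW jr) zB; have [_ hy _] := hom (ltnW (ltnW jr)) yj.
  by rewrite -hy -hz; have [_ _ hn'] := hom' (ltnW jr) hzB; apply: hn'.
move=> xQ yx; have xB : x \in ball e j.+1 v by apply: ball_cnbh yj _; rewrite cnbhC.
exists (h x); first by apply: imset_f; rewrite inE xQ.
by have [_ _ hn] := hom (ltnW jr) xB; apply: hn.
Qed.

Lemma setD_cov_image j (X Q : {set T}) : j.+1 < r -> X \subset ball e j v ->
  (h @: X) :\: cov e' (h @: (Q :&: ball e j.+1 v)) = h @: (X :\: cov e Q).
Proof.
move=> jr XB; apply/setP => y'; apply/setDP/imsetP => [[/imsetP[y yX ->]]|[y]].
  by rewrite mem_cov_image ?(subsetP XB) // => yQ; exists y => //; rewrite inE yQ.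
move=> /setDP[yX yQ] ->; rewrite imset_f // mem_cov_image ?(subsetP XB) //.
Qed.

Lemma near_image q m L i j z w : i < r -> j.+2 < r ->
  z \in ball e j v -> w \in ball e i v ->
  near e q m L z w -> near e' q m L (h z) (h w).
Proof.
move=> ir jr zj wi /existsP[Q /and3P[Qq LQ mQ]].
have zB : cnbh e z \subset ball e j.+1 v.
  by apply/subsetP => y; exact: ball_cnbh.
have cB (X : {set T}) : X \subset cnbh e z -> #|h @: X| = #|X|.
  move=> Xz; apply/card_ball_image/(subset_trans Xz)/(subset_trans zB).
  by apply: ball_mono; lia.
apply/existsP; exists (h @: (Q :&: ball e j.+2 v)); apply/and3P; split.
- apply: leq_trans (leq_imset_card _ _) (leq_trans _ Qq).
  exact/subset_leq_card/subsetIl.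
- rewrite (cnbh_image _ zj) ?setD_cov_image ?cB ?subsetDl //; lia.
- rewrite (cnbh_image _ zj) ?setD_cov_image ?cB ?subsetDl //; last lia.
  apply: leq_trans mQ _; rewrite leq_mul2l; apply/orP; right.
  rewrite -cB; last by rewrite (subset_trans (subsetDl _ _)) ?subsetIl.
  rewrite -(@setD_cov_image j.+1) ?(subset_trans (subsetIl _ _)) //.
  rewrite subset_leq_card // setSD // (cnbh_image ir wi).
  by rewrite subsetI !imsetS ?subsetIl ?subsetIr.
Qed.
End Transport.

Section TransportIff.
Variables (r : nat) (T : finType) (e : rel T) (v : T).
Variables (T' : finType) (e' : rel T') (v' : T') (h : T -> T') (h' : T' -> T).
Hypotheses (se : symmetric e) (se' : symmetric e')
  (hom : ball_hom r e v e' v' h h') (hom' : ball_hom r e' v' e v h' h).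

Lemma near_transport q m L i j z w : i < r -> j.+2 < r ->
  z \in ball e j v -> w \in ball e i v ->
  near e' q m L (h z) (h w) = near e q m L z w.
Proof.
move=> ir jr zj wi; apply/idP/idP; last exact: (near_image se hom hom' ir jr zj wi).
have [hzj hz _] := hom (ltnW (ltnW (ltnW jr))) zj; have [hwi hw _] := hom (ltnW ir) wi.
by move=> /(near_image se' hom' hom ir jr hzj hwi); rewrite hz hw.
Qed.

(** Relevant members of the cover are within j + 2 of the root, and testing nearness to them looks
    two steps further. *)
Lemma deferring_transport k q m L j x (Z : {set T}) : j.+4 < r -> x \in ball e j v ->
  deferring e k q m L x Z ->
  deferring e' k q m L (h x) (h @: (Z :&: ball e j.+2 v)).
Proof.
move=> jr xj /and3P[Zk xZ nZ].
have xB : cnbh e x \subset ball e j.+1 v by apply/subsetP => y; exact: ball_cnbh.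
apply/and3P; split.
- apply: leq_trans (leq_imset_card _ _) (leq_trans _ Zk).
  exact/subset_leq_card/subsetIl.
- rewrite (cnbh_image hom hom' _ xj); last by lia.
  apply/subsetP => _ /imsetP[y yx ->].
  rewrite (mem_cov_image se hom hom') ?(subsetP xB) ?(subsetP xZ) //; lia.
- apply/forall_inP => _ /imsetP[z /setIP[zZ zB] ->].
  rewrite (near_transport _ _ _ _ _ zB xj) ?(forall_inP nZ) //; lia.
Qed.
End TransportIff.

Section Selected.
Variables (r : nat) (T : finType) (e : rel T) (v : T).
Variables (T' : finType) (e' : rel T') (v' : T') (h : T -> T') (h' : T' -> T).
Hypotheses (se : symmetric e) (se' : symmetric e')
  (hom : ball_hom r e v e' v' h h') (hom' : ball_hom r e' v' e v h' h).

Lemma selected_transport k q m L j x : j.+4 < r -> x \in ball e j v ->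
  (h x \in selected e' k q m L) = (x \in selected e k q m L).
Proof.
move=> jr xj; rewrite !inE; congr (~~ _).
have jr' : j <= r by lia.
have [hxj hx _] := hom jr' xj.
apply/existsP/existsP => -[Z dZ].
  exists (h' @: (Z :&: ball e' j.+2 v')); rewrite -hx.
  exact: (deferring_transport se' se hom' hom jr hxj dZ).
exists (h @: (Z :&: ball e j.+2 v)).
exact: (deferring_transport se se' hom hom' jr xj dZ).
Qed.

Lemma domset_transport k q m L : 5 < r -> h v = v' ->
  v \in domset e k q m L -> v' \in domset e' k q m L.
Proof.
move=> r5 hv; have v0 : v \in ball e 0 v by rewrite inE.
rewrite !in_setU !in_setC -{1}hv (selected_transport _ _ _ _ _ v0); last by lia.
case/orP=> [->//|vS]; apply/orP; right; apply: contra vS => /covP[x' x'S vx'].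
have x'1 : x' \in ball e' 1 v' by apply: (@ball_cnbh _ _ _ 0 v'); rewrite ?set11 // cnbhC.
have r1 : 1 <= r by lia.
have [hx'1 hx' hn'] := hom' r1 x'1.
apply/covP; exists (h' x').
  by rewrite -(selected_transport _ _ _ _ _ hx'1) ?hx' //; lia.
have [_ <- _] := hom (leq0n r) v0; rewrite hv; apply: hn' => //; lia.
Qed.
End Selected.

(** * From equal views to ball maps *)

Lemma same_view_sym r (T : finType) (e : rel T) id v (T' : finType) (e' : rel T') id' v' :
  same_view r e id v e' id' v' -> same_view r e' id' v' e id v.
Proof.
case=> E [H1 H2]; split=> //; split=> [n|n m]; first by split=> /H1.
by split=> /H2.
Qed.

Definition view_map r (T : finType) (id : T -> nat)
    (T' : finType) (e' : rel T') (id' : T' -> nat) (v' : T') (x : T) : T' :=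
  odflt v' [pick u' in ball e' r v' | id' u' == id x].

Section View.
Variables (r : nat) (T : finType) (e : rel T) (id : T -> nat) (v : T).
Variables (T' : finType) (e' : rel T') (id' : T' -> nat) (v' : T').
Hypotheses (iid' : injective id')
  (sv : same_view r e id v e' id' v').

Lemma view_mapP x : x \in ball e r v ->
  view_map r id e' id' v' x \in ball e' r v' /\ id' (view_map r id e' id' v' x) = id x.
Proof.
case: sv => _ [H _] xr; rewrite /view_map; case: pickP => [u /andP[ur /eqP//]|no].
have [u' u'r E] : exists2 u', u' \in ball e' r v' & id' u' = id x by apply/H; exists x.
by move: (no u'); rewrite u'r E eqxx.
Qed.

Lemma view_map_root : view_map r id e' id' v' v = v'.
Proof.
have [|_ E] := @view_mapP v; first by apply: (subsetP (ball_mono e v (leq0n r))); rewrite inE.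
by apply: iid'; rewrite E; case: sv.
Qed.
End View.

(** By injectivity, an edge of the other view with the right identifiers joins the images; distances
    to the root then transfer by induction. *)
Lemma view_hom r (T : finType) (e : rel T) (id : T -> nat) (v : T)
    (T' : finType) (e' : rel T') (id' : T' -> nat) (v' : T') :
  injective id -> injective id' -> same_view r e id v e' id' v' ->
  ball_hom r e v e' v' (view_map r id e' id' v') (view_map r id' e id v).
Proof.
move=> iid iid' sv.
set h := view_map r id _ _ _; set h' := view_map r _ _ _ _.
have hP x : x \in ball e r v -> h x \in ball e' r v' /\ id' (h x) = id x.
  exact: view_mapP sv x.
have h'P x : x \in ball e' r v' -> h' x \in ball e r v /\ id (h' x) = id' x.
  exact: view_mapP (same_view_sym sv) x.
have hn j x : j < r -> x \in ball e j v -> forall y, y \in cnbh e x -> h y \in cnbh e' (h x).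
  move=> jr xj y; rewrite [y \in _]inE => /orP[/eqP->|exy]; first exact: cnbh_refl.
  have xr : x \in ball e r v by apply: (subsetP (ball_mono e v (ltnW jr))).
  have yr : y \in ball e r v.
    apply: (subsetP (ball_mono e v jr)); apply: ball_cnbh xj _.
    by rewrite inE exy orbT.
  have [_ [_ sve]] := sv.
  have [u [w [/andP[euw _] ux wy]]] : exists u w,
      [/\ view_edge e' r v' u w, id' u = id x & id' w = id y].
    apply/sve; exists x, y; split=> //; rewrite /view_edge exy /=; apply/orP; left.
    by case: (r) jr => // r'; rewrite ltnS => jr; apply: (subsetP (ball_mono e v jr)).
  have -> : h y = w by apply: iid'; rewrite wy; case: (hP y yr).
  have -> : h x = u by apply: iid'; rewrite ux; case: (hP x xr).
  by rewrite inE euw orbT.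
have hj j x : j <= r -> x \in ball e j v -> h x \in ball e' j v'.
  elim: j x => [|j IH] x jr.
    by rewrite !inE => /eqP->; apply/eqP/(view_map_root iid' sv).
  case/setUP=> [xj|]; first by rewrite /= inE IH // ltnW.
  rewrite inE => /exists_inP[w wj ewx]; apply: (@ball_cnbh _ _ _ j (h w)).
    by apply: IH => //; exact: ltnW.
  by apply: (hn j) => //; rewrite inE ewx orbT.
move=> j x jr xj; have xr : x \in ball e r v by apply: (subsetP (ball_mono e v jr)).
split; [exact: hj | | by move=> jr'; exact: (hn j)].
have [hxr E] := hP x xr; have [_ E'] := h'P _ hxr.
by apply: iid; rewrite E' E.
Qed.

Theorem theorem1 (d : nat) (hd : 0 < d) :
  exists (r c : nat) (A : dist_alg),
    local_in_rounds r A /\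
    forall (T : finType) (e : rel T) (id : T -> nat),
      simple_graph e -> injective id -> nabla1_le e d ->
      dominating e (output_set A e id) /\
      #|output_set A e id| <= c * gamma e.
Proof.
have [c Hc] := card_alg_set d.
(* Neighbours of v are at distance 1, their covers within 3, the sets Q of [near] within 5; seeing
   the neighbourhoods of Q takes a sixth round. *)
exists 6, c, (fun T e _ v => v \in alg_set d e); split.
  move=> T e id v T' e' id' v' [se _] iid [se' _] iid' sv.
  have sv' := same_view_sym sv.
  apply/idP/idP.
    apply: (domset_transport se se' (view_hom iid iid' sv) (view_hom iid' iid sv')) => //.
    exact: view_map_root sv.
  apply: (domset_transport se' se (view_hom iid' iid sv') (view_hom iid iid' sv)) => //.
  exact: view_map_root sv'.
move=> T e id se iid ne.
have -> : output_set (fun T e _ v => v \in alg_set d e) e id = alg_set d e.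
  by apply/setP => v; rewrite inE.
by split; [apply: dominating_alg_set; case: se | exact: Hc].
Qed.
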